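(* For every system $T\subseteq\{x_i+1=x_k,\ x_i\cdot x_j=x_k:\ i,j,k\in\{1,2,3\}\}$ which has only finitely many solutions in positive integers $x_1,x_2,x_3$, each such solution satisfies $x_1,x_2,x_3\leqslant f(3)=4$.
   Context: Here $f(3)=2^{2^{1}}=4$, the value at $n=3$ of the function $f$ with $f(1)=1$, $f(n)=2^{2^{n-2}}$ for $n\in\{2,3,4,5\}$, $f(n)=\left(2+2^{2^{n-4}}\right)^{2^{n-4}}$ for $n\geqslant6$. *)

(* Defs.v *)
From mathcomp Require Import all_boot.
From mathcomp Require Import boolp classical_sets functions cardinality.
Set Implicit Arguments.
Unset Strict Implicit.
Unset Printing Implicit Defensive.

Local Open Scope classical_set_scope.

(* The variables x_1, ..., x_n are indexed by 'I_n, i.e. from 0 to n - 1;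
   the indices in one equation need not be distinct. *)
Inductive equation (n : nat) : Type :=
| SuccEq (i k : 'I_n)       (* x_i + 1 = x_k *)
| MulEq (i j k : 'I_n).     (* x_i * x_j = x_k *)

Definition holds (n : nat) (x : {ffun 'I_n -> nat}) (e : equation n) : Prop :=
  match e with
  | SuccEq i k => x i + 1 = x k
  | MulEq i j k => x i * x j = x k
  end.

Definition positive_solutions (n : nat) (T : set (equation n)) :
    set {ffun 'I_n -> nat} :=
  [set x : {ffun 'I_n -> nat} |
    (forall i : 'I_n, 0 < x i) /\ (forall e, T e -> holds x e)].

(* Only the values at n >= 1 are meaningful; f 0 = 1 is a dummy value. *)
Definition f (n : nat) : nat :=
  if n <= 1 then 1
  else if n <= 5 then 2 ^ (2 ^ (n - 2))
  else (2 + 2 ^ (2 ^ (n - 4))) ^ (2 ^ (n - 4)).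

(* Main.v *)
(** Let [x] be a solution with a coordinate above [4]. The equations that [x]
    satisfies depend only on which relations [p + 1 = q] and [p * q = r] hold
    among its values. Embed these values in a set [{w < u < m}] with [m > 4]:
    the relations that can then hold among [w], [u], [m] are few, any compatible
    family of them has solutions with [m] arbitrarily large, and substituting
    such a solution for the values of [x] gives unboundedly large solutions
    of the system. *)
Require Import Defs.
From mathcomp Require Import all_boot.
From mathcomp Require Import boolp classical_sets functions cardinality.
From mathcomp Require Import zify.
Set Implicit Arguments.
Unset Strict Implicit.
Unset Printing Implicit Defensive.

(* The seven implications exhaust the relations possible when [0 < w < u < m];
   [w = 1] stands for [w * w = w], [w * u = u] and [w * m = m]. *)
Lemma large_relation_preserving_triple (w u m N : nat) :
  0 < w -> w < u -> u < m -> 4 < m ->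
  exists w' u' m' : nat,
    [/\ 0 < w', 0 < u', N < m' & w = 1 -> w' = 1] /\
    [/\ w + 1 = u -> w' + 1 = u', w * w = u -> w' * w' = u'
      & u + 1 = m -> u' + 1 = m'] /\
    [/\ w * w = m -> w' * w' = m', w * u = m -> w' * u' = m'
      & u * u = m -> u' * u' = m'].
Proof.
move=> w_gt0 lt_wu lt_um m_gt4.
(* At most one of the three products can equal [m]. For [w] at least 2, the doubling bounds also
   rule out [w * w = w + 1] and [w * u = u + 1]. *)
have lt_ww_wu : w * w < w * u by nia.
have lt_wu_uu : w * u < u * u by nia.
have le_ww : w = 1 \/ 2 * w <= w * w by nia.
have le_wu : w = 1 \/ 2 * u <= w * u by nia.
(* [t] is beyond [N], and at least 2 so that [t * t - 1] is positive. *)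
have [t tE] : exists t, t = N + 2 by exists (N + 2).
have le_tt : 2 * t <= t * t by nia.
(* The outer cases say which relation produces [m]; only [u + 1 = m] and [w * w = m] can hold
   together. *)
have [um|um] := eqVneq (u + 1) m.
  (* The triples (1, 2, 3), (1, 2, 4) and (2, 3, 4) are determined by their relations and have no
     larger copy; [4 < m] excludes exactly these. *)
  have [w1|w1] := eqVneq w 1.
    by exists 1, t, (t + 1); do !split; nia.
  have [wu|wu] := eqVneq (w + 1) u.
    by exists t, (t + 1), (t + 2); do !split; nia.
  have [wwu|wwu] := eqVneq (w * w) u.
    by exists t, (t * t), (t * t + 1); do !split; nia.
  have [wwm|wwm] := eqVneq (w * w) m.
    by exists t, (t * t - 1), (t * t); do !split; nia.
  by exists w, t, (t + 1); do !split; nia.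
have [uum|uum] := eqVneq (u * u) m.
  have [w1|w1] := eqVneq w 1.
    by exists 1, t, (t * t); do !split; nia.
  have [wu|wu] := eqVneq (w + 1) u.
    by exists t, (t + 1), ((t + 1) * (t + 1)); do !split; nia.
  have [wwu|wwu] := eqVneq (w * w) u.
    by exists t, (t * t), ((t * t) * (t * t)); do !split; nia.
  by exists w, t, (t * t); do !split; nia.
have [wwm|wwm] := eqVneq (w * w) m.
  have [wu|wu] := eqVneq (w + 1) u.
    by exists t, (t + 1), (t * t); do !split; nia.
  (* No relation constrains [u] here, so it stays, even if [t] exceeds it: the new triple need not
     be increasing. *)
  by exists t, u, (t * t); do !split; nia.
have [wum|wum] := eqVneq (w * u) m.
  have [wu|wu] := eqVneq (w + 1) u.
    by exists t, (t + 1), (t * (t + 1)); do !split; nia.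
  have [wwu|wwu] := eqVneq (w * w) u.
    by exists t, (t * t), (t * (t * t)); do !split; nia.
  by exists w, t, (w * t); do !split; nia.
(* Nothing produces [m] from [w] and [u], so [m] moves alone. *)
by exists w, u, t; do !split; nia.
Qed.

Lemma large_relation_preserving_map (w u m N : nat) :
  0 < w -> w < u -> u < m -> 4 < m ->
  exists g : nat -> nat,
    [/\ N < g m,
        {in [:: w; u; m], forall p, 0 < g p},
        {in [:: w; u; m] &, forall p q, p + 1 = q -> g p + 1 = g q}
      & {in [:: w; u; m] & &, forall p q r, p * q = r -> g p * g q = g r}].
Proof.
move=> w_gt0 lt_wu lt_um m_gt4.
have [w' [u' [m' [[w'0 u'0 m'N w1] [[wu wwu um] [wwm wum uum]]]]]] :=
  large_relation_preserving_triple N w_gt0 lt_wu lt_um m_gt4.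
pose g z := if z == w then w' else if z == u then u' else m'.
have gw : g w = w' by rewrite /g eqxx.
have gu : g u = u' by rewrite /g eqxx gtn_eqF.
have gm : g m = m' by rewrite /g !gtn_eqF // (ltn_trans lt_wu).
exists g; split.
- by rewrite gm.
- by move=> p; rewrite !inE => /or3P[] /eqP ->; rewrite ?gw ?gu ?gm; lia.
- move=> p q; rewrite !inE => /or3P[] /eqP -> /or3P[] /eqP ->;
    by rewrite ?gw ?gu ?gm => ?; (lia || exfalso; nia).
(* Each product relation is one of the four of the triple, or [u * w = m], or impossible, or a
   multiplication by [w] that forces [w = 1]. *)
move=> p q r; rewrite !inE => /or3P[] /eqP -> /or3P[] /eqP -> /or3P[] /eqP ->;
  rewrite ?gw ?gu ?gm => e;
  first [ by apply: wwu | by apply: wwm | by apply: wum | by apply: uum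
        | by rewrite mulnC; apply: wum; rewrite mulnC
        | by exfalso; nia
        | by rewrite (w1 _) ?mul1n ?muln1 //; nia ].
Qed.

(** The maximum is one of the three values, so only the other two need places. When they coincide or
    equal the maximum, 1 and 2, both below it, fill the gaps. *)
Lemma values_in_triple (a b c : nat) :
  0 < a -> 0 < b -> 0 < c -> 4 < maxn a (maxn b c) ->
  exists w u : nat, let m := maxn a (maxn b c) in
    [/\ 0 < w, w < u, u < m & {subset [:: a; b; c] <= [:: w; u; m]}].
Proof.
move=> a0 b0 c0; set m := maxn a _ => m4.
suff [w [u [w0 wu um [ha hb hc]]]] : exists w u,
    [/\ 0 < w, w < u, u < m &
      [/\ a \in [:: w; u; m], b \in [:: w; u; m] & c \in [:: w; u; m]]].
  by exists w, u; split=> //; apply/allP; rewrite [all _ _]/= ha hb hc.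
have pair p q : 0 < p -> 0 < q -> p <= m -> q <= m -> exists w u,
    [/\ 0 < w, w < u, u < m & p \in [:: w; u; m] /\ q \in [:: w; u; m]].
  wlog le_pq : p q / p <= q => [H p0 q0 pm qm|p0 q0 pm qm].
    have [le_pq|/ltnW le_qp] := leqP p q; first exact: H.
    by have [w [u [? ? ? [? ?]]]] := H _ _ le_qp q0 p0 qm pm; exists w, u.
  have single r : 0 < r -> r <= m -> exists w u,
      [/\ 0 < w, w < u, u < m & r \in [:: w; u; m]].
    move=> r0 rm; have [r1|r1] := eqVneq r 1.
      by exists 1, 2; split; rewrite ?inE; lia.
    have [->|rm'] := eqVneq r m; first by exists 1, 2; split; rewrite ?inE; lia.
    by exists 1, r; split; rewrite ?inE; lia.
  have [->|qm'] := eqVneq q m.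
    have [w [u [? ? ? ?]]] := single p p0 pm.
    by exists w, u; split=> //; split; rewrite // !inE eqxx !orbT.
  have [->|pq] := eqVneq p q; last by exists p, q; split; rewrite ?inE; lia.
  by have [w [u [? ? ? ?]]] := single q q0 qm; exists w, u.
have [am|[bm|cm]] : a = m \/ b = m \/ c = m by lia.
- have [||||w [u [? ? ? [? ?]]]] := pair b c; try lia.
  by exists w, u; split=> //; split; rewrite // am !inE eqxx !orbT.
- have [||||w [u [? ? ? [? ?]]]] := pair a c; try lia.
  by exists w, u; split=> //; split; rewrite // bm !inE eqxx !orbT.
have [||||w [u [? ? ? [? ?]]]] := pair a b; try lia.
by exists w, u; split=> //; split; rewrite // cm !inE eqxx !orbT.
Qed.

Lemma ord3_cases (P : 'I_3 -> Prop) :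
  P (inord 0) -> P (inord 1) -> P (inord 2) -> forall i, P i.
Proof.
move=> P0 P1 P2 i; rewrite -[i]inord_val.
by case: i => [[|[|[|]]]].
Qed.

Lemma finite_set_ffun_bounded (I : finType) (A : set {ffun I -> nat}) :
  finite_set A -> exists N, forall y, A y -> forall i, y i <= N.
Proof.
move=> /finite_seqP[s ->]; exists (\max_(y <- s) \max_i y i) => y ys i.
by apply: leq_trans (leq_bigmax_seq _ ys _); rewrite ?(leq_bigmax i).
Qed.

Theorem theorem9 :
  f 3 = 4 /\
  forall T : set (equation 3),
    finite_set (positive_solutions T) ->
    forall x : {ffun 'I_3 -> nat}, positive_solutions T x ->
    forall i : 'I_3, x i <= f 3.
Proof.
have f3 : f 3 = 4 by [].
split=> // T /finite_set_ffun_bounded[N leN] x [x_gt0 xT] i.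
rewrite leqNgt; apply/negP; rewrite f3 => xi_gt4.
set a := x (inord 0); set b := x (inord 1); set c := x (inord 2).
have m_gt4 : 4 < maxn a (maxn b c).
  apply: leq_trans xi_gt4 _; move: i; apply: ord3_cases; rewrite -/a -/b -/c; lia.
have [w [u]] := values_in_triple (x_gt0 _) (x_gt0 _) (x_gt0 _) m_gt4.
move=> /= [w_gt0 lt_wu lt_um sub].
have [g [gN g_gt0 gS gM]] :=
  large_relation_preserving_map N w_gt0 lt_wu lt_um m_gt4.
have xin j : x j \in [:: w; u; maxn a (maxn b c)].
  by apply: sub; move: j; apply: ord3_cases; rewrite !inE eqxx ?orbT.
(* Only the image of the maximum is known to exceed [N], and [i] need not attain it. *)
have [j xj] : exists j, x j = maxn a (maxn b c).
  have [e|[e|e]] : a = maxn a (maxn b c) \/ b = maxn a (maxn b c)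
                   \/ c = maxn a (maxn b c) by lia.
  - by exists (inord 0).
  - by exists (inord 1).
  by exists (inord 2).
suff /leN/(_ j) : positive_solutions T [ffun k => g (x k)].
  by rewrite ffunE xj leqNgt gN.
split=> [k|e /xT]; first by rewrite ffunE g_gt0.
by case: e => [p q|p q r] /=; rewrite !ffunE; [apply: gS | apply: gM].
Qed.
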